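(* Let $X\subset\mathbb{R}^n$ be a compact convex semialgebraic set and let $f:\mathbb{R}^n\to\mathbb{R}$ be a polynomial positive on $X$. Assume that there is $\mu>0$ such that for every $\xi\in X$ the function $\varphi_\xi(x)=e^{|x-\xi|^2}f(x)$ is $\mu$-strongly convex on $X$. Let $a_0\in X$ and let $(a_\nu)$ be the sequence defined by $a_\nu:=\operatorname{argmin}_X\varphi_{a_{\nu-1}}$ for $\nu\ge 1$. Then the limit $a_*=\lim_{\nu\to\infty}a_\nu$ exists and $a_*\in\Sigma_Xf$.
   Context: $|\cdot|$ is the Euclidean norm on $\mathbb{R}^n$. A function $\varphi$ is $\mu$-strongly convex on a convex set $X$ if $\varphi(x)-\frac{\mu}{2}|x|^2$ is convex on $X$. For a strictly convex continuous function $\varphi$ on a compact convex set $X$, $\operatorname{argmin}_X\varphi$ denotes the unique point of $X$ at which $\varphi$ attains its minimum on $X$. $\Sigma_Xf$ denotes the set of lower critical points of $f$ on $X$: for convex $X$ these are the points $a\in X$ with $\langle\nabla f(a),x-a\rangle\ge 0$ for all $x\in X$. *)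

(* Defs.v *)
From HB Require Import structures.
From mathcomp Require Import all_boot all_order all_algebra.
From mathcomp Require Import all_classical all_reals all_analysis.
(* The notations of mpoly clash with those of MathComp-Analysis. *)
From mathcomp Require Import -(notations) mpoly.

Set Implicit Arguments.
Unset Strict Implicit.
Unset Printing Implicit Defensive.

Import Order.TTheory GRing.Theory Num.Theory.
Import numFieldNormedType.Exports.

Local Open Scope classical_set_scope.
Local Open Scope ring_scope.

Definition polyfun (R : realType) (n : nat) (p : mpoly n R)
    (x : 'rV[R]_n) : R :=
  meval (fun i => x 0 i) p.

(* The smallest family of subsets of R^n that contains the sets {p > 0}, for p
   a polynomial, and is closed under complements and finite unions. *)
Inductive semialgebraic (R : realType) (n : nat) : set 'rV[R]_n -> Prop :=
| semialgebraic_gt0 (p : mpoly n R) :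
    semialgebraic [set x | 0 < polyfun p x]
| semialgebraic_setC (A : set 'rV[R]_n) :
    semialgebraic A -> semialgebraic (~` A)
| semialgebraic_setU (A B : set 'rV[R]_n) :
    semialgebraic A -> semialgebraic B -> semialgebraic (A `|` B).

Definition dot (R : realType) (n : nat) (u v : 'rV[R]_n) : R :=
  \sum_(i < n) u 0 i * v 0 i.

(* The Euclidean norm; the library norm `|x| on row vectors is the sup norm. *)
Definition enorm (R : realType) (n : nat) (x : 'rV[R]_n) : R :=
  Num.sqrt (dot x x).

Definition gradient (R : realType) (n : nat) (f : 'rV[R]_n -> R)
    (x : 'rV[R]_n) : 'rV[R]_n :=
  \row_(i < n) 'D_(delta_mx 0 i) f x.

Definition strongly_convex (R : realType) (n : nat) (mu : R)
    (X : set 'rV[R]_n) (phi : 'rV[R]_n -> R) : Prop :=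
  @convex_function R 'rV[R]_n X (fun x => phi x - mu / 2 * enorm x ^+ 2).

(* A minimum point of phi on X, unique when phi is continuous and strictly
   convex on the nonempty compact convex set X; the default 0 is used only when
   there is no minimum point. *)
Definition argmin (R : realType) (n : nat) (X : set 'rV[R]_n)
    (phi : 'rV[R]_n -> R) : 'rV[R]_n :=
  xget 0 [set a | X a /\ forall x, X x -> phi a <= phi x].

Definition exp_prox (R : realType) (n : nat) (f : 'rV[R]_n -> R)
    (xi x : 'rV[R]_n) : R :=
  expR (enorm (x - xi) ^+ 2) * f x.

(* The lower critical points of f on X, for X convex. *)
Definition lower_critical (R : realType) (n : nat) (X : set 'rV[R]_n)
    (f : 'rV[R]_n -> R) : set 'rV[R]_n :=
  [set a | X a /\ forall x, X x -> 0 <= dot (gradient f a) (x - a)].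

(* Main.v *)
Require Import Defs.
From HB Require Import structures.
From mathcomp Require Import all_boot all_order all_algebra.
From mathcomp Require Import all_classical all_reals all_analysis.
From mathcomp Require Import -(notations) mpoly.
From mathcomp Require ordered_qelim polyrcf qe_rcf.
From mathcomp Require Import zify ring lra.

Set Implicit Arguments.
Unset Strict Implicit.
Unset Printing Implicit Defensive.

Import Order.TTheory GRing.Theory Num.Theory.
Import numFieldNormedType.Exports.

Local Open Scope classical_set_scope.
Local Open Scope ring_scope.

(** The objective need not have isolated critical points, so the descent of
    [f] along the sequence does not give convergence; the sequence has to be
    shown to have finite length, and this is where semialgebraicity enters.

    Write [d_k] for the length of the step [a_k+1 - a_k] and [t_k] for
    [f a_k+1].  Minimality of [a_k+1] and the inequality [1 + r <= exp r] give
    two facts.  Comparison with the point [a_k] gives the descent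
    [m * d_k^2 <= f a_k - f a_k+1], where [m > 0] is the minimum of [f] on [X]
    ([prox_descent]).  Comparison with an arbitrary [y] in [X] says that the
    point [x = a_k+1] and the step [v = a_k+1 - a_k] form a proximal pair:
    [f x * (1 - 2 <y - x, v> - |y - x|^2) <= f y] for all [y] in [X]
    ([prox_pairs_argmin]).  This is a bound on how steeply [f] can decrease
    from [x] inside [X], with [|v|] in the role of the slope.

    On each level [f = t] consider, among the proximal pairs, those with the
    smallest [|v|], and among these the lexicographically smallest [x]; this
    singles out a point [x(t)] that depends definably on [t].  Let [x_k] be the
    point chosen at the level [t_k], [v_k] its vector, and [D_k] the l1 length
    of [x_k+1 - x_k].  The pair inequality between [x_k] and [x_k+1], in which
    [|v_k| <= d_k] by the choice of [v_k], bounds [t_k - t_k+1] by a constant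
    times [2 D_k d_k + D_k^2].  Together with the descent this gives
    [d_k+1 <= d_k / 2 + C D_k] ([prox_step_le]), so the steps [d_k] are summable
    as soon as the [D_k] are.

    The [D_k] are summable because each coordinate of the bounded curve [x(t)]
    has bounded variation along the decreasing levels [t_k].  By quantifier
    elimination the condition [x_i(t) > u] is a boolean combination of
    polynomial sign conditions in [t] and [u], whose degree in [t] does not
    depend on [u]; hence its truth value changes at most [N] times along a
    monotone sequence of levels, with [N] independent of [u]
    ([definable_alternations]).  A sequence in an interval that crosses every
    threshold at most [N] times has variation at most [N] times the length of
    the interval ([variation_le]).

    So [(a_k)] converges.  The set of proximal pairs is closed, so the limit
    paired with the zero vector is a proximal pair, and the first order
    expansion of its inequality is criticality ([prox_pairs_critical]). *)

(** * First order definability over the reals *)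

Notation formula := ordered_qelim.ord.formula.
Notation holds := ordered_qelim.ord.holds.

Definition upd (T : Type) (E : nat -> T) (k : nat) (v : T) : nat -> T :=
  fun j => if j == k then v else E j.

(** Real predicates on infinitely many variables that a first order formula over
    the ordered field expresses; the formula reads missing entries of its
    environment as 0, as [nth 0] does. *)
Definition first_order (R : realType) (A : (nat -> R) -> Prop) :=
  exists phi : formula R, forall e, A (nth 0 e) <-> holds e phi.

Lemma first_order_not (R : realType) (A : (nat -> R) -> Prop) :
  first_order A -> first_order (fun r => ~ A r).
Proof.
by move=> [phi Aphi]; exists (ordered_qelim.ord.Not phi) => e /=; rewrite Aphi.
Qed.

Lemma first_order_and (R : realType) (A B : (nat -> R) -> Prop) :
  first_order A -> first_order B -> first_order (fun r => A r /\ B r).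
Proof.
move=> [phi Aphi] [psi Bpsi]; exists (ordered_qelim.ord.And phi psi) => e /=.
by rewrite Aphi Bpsi.
Qed.

Lemma first_order_forall (R : realType) (A : (nat -> R) -> Prop) (i : nat) :
  first_order A -> first_order (fun r => forall x, A (upd r i x)).
Proof.
move=> [phi Aphi]; exists (ordered_qelim.ord.Forall i phi) => e /=.
have E x : upd (nth 0 e) i x = nth 0 (set_nth 0 e i x).
  by apply/funext => j; rewrite nth_set_nth.
by split=> h x; have := h x; rewrite E Aphi.
Qed.

(** A quantifier over a vector is a block of consecutive scalar quantifiers. *)
Lemma first_order_forall_range (R : realType) (A : (nat -> R) -> Prop)
    (m l : nat) :
  first_order A ->
  first_order (fun r => forall w : nat -> R,
    A (fun j => if (m <= j < m + l)%N then w (j - m)%N else r j)).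
Proof.
elim: l A => [|l IHl] A fA.
  rewrite [X in first_order X](_ : _ = A) //; apply/funext => r.
  have E w : (fun j => if (m <= j < m + 0)%N then w (j - m)%N else r j) = r.
    by apply/funext => j; rewrite addn0; case: ifPn => //; lia.
  by apply/propext; split => [/(_ r)|Ar w]; rewrite E.
rewrite [X in first_order X](_ : _ = (fun r => forall w : nat -> R,
   forall x, A (upd (fun j => if (m <= j < m + l)%N then w (j - m)%N else r j)
     (m + l) x))); last first.
  apply/funext => r; apply/propext; split=> [Ar w x|Ar w].
    have := Ar (fun j => if j == l then x else w j).
    congr A; apply/funext => j; rewrite /upd.
    have [->|jml] := eqVneq j (m + l)%N.
      by rewrite leq_addr ltn_add2l leqnn /= addKn eqxx.
    case: ifPn => [/andP[mj jl]|]; last by case: ifPn => //; lia.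
    by rewrite (_ : (j - m)%N == l = false) ?ifT //; lia.
  have := Ar w (w l); congr A; apply/funext => j; rewrite /upd.
  have [->|jml] := eqVneq j (m + l)%N.
    by rewrite leq_addr ltn_add2l leqnn /= addKn.
  by congr (if _ then _ else _); lia.
exact: (IHl _ (first_order_forall (m + l) fA)).
Qed.

(** The variables 0 and 1 hold two scalars; the remaining ones are cut into
    consecutive blocks of length [n], each of which holds one vector. *)
Definition vars (R : realType) (n : nat) (r : nat -> R) : nat -> 'rV[R]_n :=
  fun k => \row_(i < n) r (2 + (k * n + i))%N.

(** First order predicates of two scalars and a sequence of vectors.  Shallow
    predicates closed under connectives and quantifiers make it possible to
    show definability without writing formulas. *)
Definition definable (R : realType) (n : nat)
    (B : R -> R -> (nat -> 'rV[R]_n) -> Prop) :=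
  first_order (fun r => B (r 0%N) (r 1%N) (vars n r)).

Lemma definable_not (R : realType) (n : nat)
    (B : R -> R -> (nat -> 'rV[R]_n) -> Prop) :
  definable B -> definable (fun t u E => ~ B t u E).
Proof. exact: first_order_not. Qed.

Lemma definable_and (R : realType) (n : nat)
    (B C : R -> R -> (nat -> 'rV[R]_n) -> Prop) :
  definable B -> definable C -> definable (fun t u E => B t u E /\ C t u E).
Proof. exact: first_order_and. Qed.

Lemma definable_imp (R : realType) (n : nat)
    (B C : R -> R -> (nat -> 'rV[R]_n) -> Prop) :
  definable B -> definable C -> definable (fun t u E => B t u E -> C t u E).
Proof.
move=> dB /definable_not dC; have := definable_not (definable_and dB dC).
congr definable; apply/funext => t; apply/funext => u; apply/funext => E.
apply/propext; split=> [nBC b|BC [/BC]//].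
by apply: contrapT => nC; apply: nBC.
Qed.

Lemma definable_forall (R : realType) (n : nat) (k : nat)
    (B : R -> R -> (nat -> 'rV[R]_n) -> Prop) :
  definable B -> definable (fun t u E => forall v, B t u (upd E k v)).
Proof.
move=> /(@first_order_forall_range _ _ (2 + k * n) n).
congr first_order; apply/funext => r; apply/propext.
have E (w : nat -> R) : vars n (fun j =>
    if (2 + k * n <= j < 2 + k * n + n)%N then w (j - (2 + k * n))%N else r j) =
    upd (vars n r) k (\row_i w i).
  apply/funext => j; rewrite /upd /vars; apply/rowP => i; rewrite mxE.
  have [->|jk] := eqVneq j k.
    rewrite mxE ifT ?addnA ?leq_addr ?ltn_add2l ?ltn_ord //=; congr w; lia.
  rewrite mxE ifF //; apply/negbTE; have := ltn_ord i; move: jk.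
  by rewrite neq_ltn => /orP[] jk; have := leq_mul jk (leqnn n); rewrite mulSn; lia.
split=> [Bw v|Bv w]; last by rewrite E; exact: Bv.
pose w i := if insub i is Some j then v 0 j else 0.
have := Bw w; rewrite E; congr (B _ _ (upd _ _ _)).
by apply/rowP => i; rewrite mxE /w valK.
Qed.

Lemma definable_exists (R : realType) (n : nat) (k : nat)
    (B : R -> R -> (nat -> 'rV[R]_n) -> Prop) :
  definable B -> definable (fun t u E => exists v, B t u (upd E k v)).
Proof.
move=> /definable_not/(definable_forall k)/definable_not; congr definable.
apply/funext => t; apply/funext => u; apply/funext => E; apply/propext.
split=> [/existsNP[v /contrapT Bv]|[v Bv] /(_ v) nBv]; first by exists v.
exact: nBv Bv.
Qed.

Definition polynomial_in (R : realType) (n : nat)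
    (P : R -> R -> (nat -> 'rV[R]_n) -> R) :=
  exists s : GRing.term R,
    forall e, GRing.eval e s = P e`_0 e`_1 (vars n (nth 0 e)).

Lemma polynomial_in_cst (R : realType) (n : nat) (c : R) :
  polynomial_in (fun _ _ (_ : nat -> 'rV[R]_n) => c).
Proof. by exists (GRing.Const c). Qed.

Lemma polynomial_in_fst (R : realType) (n : nat) :
  polynomial_in (fun t _ (_ : nat -> 'rV[R]_n) => t).
Proof. by exists (GRing.Var R 0). Qed.

Lemma polynomial_in_snd (R : realType) (n : nat) :
  polynomial_in (fun _ u (_ : nat -> 'rV[R]_n) => u).
Proof. by exists (GRing.Var R 1). Qed.

Lemma polynomial_in_coord (R : realType) (n k : nat) (i : 'I_n) :
  polynomial_in (fun _ _ (E : nat -> 'rV[R]_n) => E k 0 i).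
Proof. by exists (GRing.Var R (2 + (k * n + i))) => e; rewrite mxE. Qed.

Lemma polynomial_inD (R : realType) (n : nat)
    (P Q : R -> R -> (nat -> 'rV[R]_n) -> R) :
  polynomial_in P -> polynomial_in Q ->
  polynomial_in (fun t u E => P t u E + Q t u E).
Proof. by move=> [s sP] [s' sQ]; exists (GRing.Add s s') => e /=; rewrite sP sQ. Qed.

Lemma polynomial_inM (R : realType) (n : nat)
    (P Q : R -> R -> (nat -> 'rV[R]_n) -> R) :
  polynomial_in P -> polynomial_in Q ->
  polynomial_in (fun t u E => P t u E * Q t u E).
Proof. by move=> [s sP] [s' sQ]; exists (GRing.Mul s s') => e /=; rewrite sP sQ. Qed.

Lemma polynomial_inB (R : realType) (n : nat)
    (P Q : R -> R -> (nat -> 'rV[R]_n) -> R) :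
  polynomial_in P -> polynomial_in Q ->
  polynomial_in (fun t u E => P t u E - Q t u E).
Proof.
by move=> [s sP] [s' sQ]; exists (GRing.Add s (GRing.Opp s')) => e /=; rewrite sP sQ.
Qed.

Lemma polynomial_in_sum (R : realType) (n : nat) (I : Type) (s : seq I)
    (P : I -> R -> R -> (nat -> 'rV[R]_n) -> R) :
  (forall i, polynomial_in (P i)) ->
  polynomial_in (fun t u E => \sum_(i <- s) P i t u E).
Proof.
move=> pP; elim: s => [|i s IHs].
  rewrite [X in polynomial_in X](_ : _ = (fun _ _ _ => 0)).
    exact: polynomial_in_cst.
  by do 3 apply/funext => ?; rewrite big_nil.
rewrite [X in polynomial_in X](_ : _ = (fun t u E =>
    P i t u E + \sum_(i <- s) P i t u E)); last first.
  by do 3 apply/funext => ?; rewrite big_cons.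
exact: polynomial_inD.
Qed.

Lemma polynomial_in_polyfun (R : realType) (n k : nat) (p : mpoly n R) :
  polynomial_in (fun _ _ E => polyfun p (E k)).
Proof.
rewrite [X in polynomial_in X](_ : _ = (fun t u (E : nat -> 'rV[R]_n) =>
    \sum_(m <- msupp p) mcoeff m p * \prod_i (E k 0 i) ^+ (m i))); last first.
  by do 3 apply/funext => ?; exact: mevalE.
apply: polynomial_in_sum => m; apply: polynomial_inM.
  exact: polynomial_in_cst.
elim: (index_enum _) => [|i s IHs].
  rewrite [X in polynomial_in X](_ : _ = (fun _ _ _ => 1)).
    exact: polynomial_in_cst.
  by do 3 apply/funext => ?; rewrite big_nil.
rewrite [X in polynomial_in X](_ : _ = (fun t u (E : nat -> 'rV[R]_n) =>
    E k 0 i ^+ m i * \prod_(i <- s) (E k 0 i) ^+ (m i))); last first.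
  by do 3 apply/funext => ?; rewrite big_cons.
apply: polynomial_inM => //; have [s' s'P] := @polynomial_in_coord R n k i.
by exists (GRing.Exp s' (m i)) => e /=; rewrite s'P.
Qed.

Lemma definable_le (R : realType) (n : nat)
    (P Q : R -> R -> (nat -> 'rV[R]_n) -> R) :
  polynomial_in P -> polynomial_in Q ->
  definable (fun t u (E : nat -> 'rV[R]_n) => P t u E <= Q t u E).
Proof.
move=> [s sP] [s' sQ]; exists (ordered_qelim.ord.Le s s') => e /=.
by rewrite sP sQ.
Qed.

Lemma definable_lt (R : realType) (n : nat)
    (P Q : R -> R -> (nat -> 'rV[R]_n) -> R) :
  polynomial_in P -> polynomial_in Q ->
  definable (fun t u (E : nat -> 'rV[R]_n) => P t u E < Q t u E).
Proof.
move=> [s sP] [s' sQ]; exists (ordered_qelim.ord.Lt s s') => e /=.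
by rewrite sP sQ.
Qed.

Lemma definable_eq (R : realType) (n : nat)
    (P Q : R -> R -> (nat -> 'rV[R]_n) -> R) :
  polynomial_in P -> polynomial_in Q ->
  definable (fun t u (E : nat -> 'rV[R]_n) => P t u E = Q t u E).
Proof.
move=> [s sP] [s' sQ]; exists (ordered_qelim.ord.Equal s s') => e /=.
by rewrite sP sQ.
Qed.

Lemma semialgebraic_definable (R : realType) (n k : nat) (X : set 'rV[R]_n) :
  semialgebraic X -> definable (fun _ _ E => X (E k)).
Proof.
elim=> [p|A _ dA|A B _ dA _ dB].
- by apply: definable_lt; [exact: polynomial_in_cst|exact: polynomial_in_polyfun].
- exact: definable_not.
- have := definable_not (definable_and (definable_not dA) (definable_not dB)).
  congr definable; do 3 apply/funext => ?; apply/propext.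
  by rewrite not_andP !notK.
Qed.

(** * Alternations of definable conditions along a monotone sequence *)

(** With all variables but the first one fixed, a term is a polynomial in that
    variable whose degree is bounded by the shape of the term alone.  This is
    the source of all uniform bounds below. *)
Lemma rterm_polynomial (R : realType) (s : GRing.term R) : GRing.rterm s ->
  exists N : nat, forall e : seq R, exists2 q : {poly R},
    (size q <= N)%N & forall t, GRing.eval (t :: e) s = q.[t].
Proof.
elim: s => //=.
- move=> [|i] _.
    by exists 2%N => e; exists 'X => [|t]; rewrite ?size_polyX ?hornerX.
  by exists 1%N => e; exists (e`_i)%:P => [|t]; rewrite ?size_polyC_leq1 ?hornerC.
- by move=> c _; exists 1%N => e; exists c%:P => [|t];
    rewrite ?size_polyC_leq1 ?hornerC.
- by move=> c _; exists 1%N => e; exists c%:R%:P => [|t];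
    rewrite ?size_polyC_leq1 ?hornerC.
- move=> s IHs s' IHs' /andP[/IHs[N NP] /IHs'[N' N'P]].
  exists (maxn N N') => e; have [q qN qP] := NP e; have [q' qN' qP'] := N'P e.
  exists (q + q') => [|t]; last by rewrite hornerD qP qP'.
  by rewrite (leq_trans (size_polyD _ _))// geq_max !leq_max qN qN' orbT.
- move=> s IHs /IHs[N NP]; exists N => e; have [q qN qP] := NP e.
  by exists (- q) => [|t]; rewrite ?size_polyN ?hornerN ?qP.
- move=> s IHs k /IHs[N NP]; exists N => e; have [q qN qP] := NP e.
  exists (q *+ k) => [|t]; last by rewrite hornerMn qP.
  by rewrite -scaler_nat (leq_trans (size_scale_leq _ _)).
- move=> s IHs s' IHs' /andP[/IHs[N NP] /IHs'[N' N'P]].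
  exists (N + N')%N => e; have [q qN qP] := NP e; have [q' qN' qP'] := N'P e.
  exists (q * q') => [|t]; last by rewrite hornerM qP qP'.
  by rewrite (leq_trans (size_polyMleq _ _))// (leq_trans (leq_pred _)) ?leq_add.
- move=> s IHs k /IHs[N NP]; exists (N * k).+1 => e; have [q qN qP] := NP e.
  exists (q ^+ k) => [|t]; last by rewrite horner_exp qP.
  by rewrite (leq_trans (size_poly_exp_leq _ _))// ltnS leq_mul//
    (leq_trans (leq_pred _)).
Qed.

Definition alternations (b : nat -> bool) (M : nat) : nat :=
  \sum_(i < M) (b i != b i.+1).

(** Membership in an upward closed set is lost at most once along a
    nonincreasing sequence. *)
Lemma alternations_decreasing (R : realType) (tau : nat -> R) (c : pred R) M :
  (forall x y, x <= y -> c x -> c y) ->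
  (forall i, tau i.+1 <= tau i) ->
  (alternations (fun i => c (tau i)) M <= 1)%N.
Proof.
move=> cle tau_le.
suff : (alternations (fun i => c (tau i)) M + c (tau M) = c (tau 0))%N.
  by case: (c (tau 0%N)) => /=; lia.
rewrite /alternations; elim: M => [|M IHM]; first by rewrite big_ord0.
rewrite big_ord_recr /= -IHM -addnA; congr (_ + _)%N.
have := cle _ _ (tau_le M).
by case: (c (tau M)) => //; case: (c (tau M.+1)) => // /(_ isT).
Qed.

(** By the intermediate value theorem, a change of sign between [tau i.+1] and
    [tau i] requires a root [r] in that segment, and then one of the conditions
    [r <= tau] and [r < tau] changes its value there; both are needed, for a
    root can be an end point of the segment.  Each condition changes at most
    once, so every root accounts for at most two changes of sign. *)
Lemma alternations_sign (R : realType) (q : {poly R}) (tau : nat -> R) M :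
  (forall i, tau i.+1 <= tau i) ->
  (\sum_(i < M) (Num.sg q.[tau i] != Num.sg q.[tau i.+1]) <= 2 * size q)%N.
Proof.
move=> tau_le; have [->|q0] := eqVneq q 0.
  by rewrite big1 // => i _; rewrite !horner0 eqxx.
pose rs := polyrcf.rootsR q.
have rs_size : (size rs <= size q)%N.
  apply/ltnW/max_poly_roots => //; last exact: polyrcf.uniq_roots.
  by apply/allP => r; rewrite -polyrcf.roots_on_rootsR // => /andP[].
have rsP r : root q r -> r \in rs by rewrite -polyrcf.roots_on_rootsR.
have local (i : 'I_M) : ((Num.sg q.[tau i] != Num.sg q.[tau i.+1] : nat) <=
    \sum_(r <- rs) (((r <= tau i)%R != (r <= tau i.+1)%R) +
                    ((r < tau i)%R != (r < tau i.+1)%R)))%N.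
  have [//|sgN /=] := eqVneq.
  have lt_tau : tau i.+1 < tau i.
    rewrite lt_neqAle tau_le andbT; apply: contraNneq sgN => ->; exact: eqxx.
  have [r] : {x | x \in `[tau i.+1, tau i] & root q x}.
    apply: polyrcf.poly_ivt; first exact: ltW.
    rewrite leNgt -sgr_gt0 sgrM; apply: contraNN sgN.
    by case: (sgrP q.[tau i]); case: (sgrP q.[tau i.+1]) => //=;
      rewrite ?mulr0 ?mul0r ?mulr1 ?mulrN1 ?ltxx ?oppr_gt0 ?ltr10 // ltr0N1.
  rewrite in_itv /= => /andP[r1 r2] /rsP rrs.
  rewrite (big_rem r) //= r2.
  move: r1; rewrite le_eqVlt => /orP[/eqP<-|r1].
    by rewrite lt_tau ltxx /=; lia.
  by rewrite (lt_geF r1).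
apply: (leq_trans (leq_sum _ (fun i _ => local i))).
rewrite exchange_big /= mulnC; apply: (@leq_trans (size rs * 2)).
  rewrite -[X in (_ <= X * 2)%N]sum1_size big_distrl /=.
  apply: leq_sum => r _; rewrite big_split mul1n.
  apply: (@leq_add _ _ 1 1); apply: alternations_decreasing => // x y.
    by move=> xy rx; exact: le_trans rx xy.
  by move=> xy rx; exact: lt_le_trans rx xy.
by rewrite leq_mul2r rs_size.
Qed.

Lemma alternations_not b M :
  alternations (fun i => ~~ b i) M = alternations b M.
Proof. by apply: eq_bigr => i _; case: (b i); case: (b i.+1). Qed.

Lemma alternations_comb (op : bool -> bool -> bool) b c M :
  (alternations (fun i => op (b i) (c i)) M <=
   alternations b M + alternations c M)%N.
Proof.
rewrite /alternations -big_split; apply: leq_sum => i _ /=.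
by case: (b i); case: (b i.+1); case: (c i); case: (c i.+1);
  rewrite ?eqxx //=; case: (_ == _).
Qed.

(** A boolean combination changes its value only where one of its atoms does, so
    bounds for the atoms add up.  An atom is a sign condition on one
    polynomial. *)
Lemma qf_alternations (R : realType) (phi : formula R) :
  ordered_qelim.ord.qf_form phi -> ordered_qelim.ord.rformula phi ->
  exists N : nat, forall (e : seq R) (tau : nat -> R) (M : nat),
    (forall i, tau i.+1 <= tau i) ->
    (alternations (fun i => ordered_qelim.ord.qf_eval (tau i :: e) phi) M <= N)%N.
Proof.
have atom (s s' : GRing.term R) (g : R -> bool) :
    GRing.rterm s && GRing.rterm s' -> exists N : nat,
    forall (e : seq R) (tau : nat -> R) (M : nat),
    (forall i, tau i.+1 <= tau i) ->
    (alternations (fun i => g (Num.sg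
      (GRing.eval (tau i :: e) s' - GRing.eval (tau i :: e) s))) M <= N)%N.
  move=> rs.
  have /rterm_polynomial[N NP] : GRing.rterm (GRing.Add s' (GRing.Opp s)).
    by rewrite /= andbC.
  exists (2 * N)%N => e tau M tau_le; have [q qN qP] := NP e.
  apply: (@leq_trans (2 * size q)); last by rewrite leq_mul2l.
  apply: leq_trans (alternations_sign q M tau_le); apply: leq_sum => i _.
  rewrite -!qP /=.
  have [->|_] := eqVneq (Num.sg _) (Num.sg _); first by rewrite eqxx.
  exact: leq_b1.
have comb (op : bool -> bool -> bool) (b c : R -> seq R -> bool) :
  (exists N : nat, forall (e : seq R) (tau : nat -> R) (M : nat),
    (forall i, tau i.+1 <= tau i) ->
    (alternations (fun i => b (tau i) e) M <= N)%N) ->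
  (exists N : nat, forall (e : seq R) (tau : nat -> R) (M : nat),
    (forall i, tau i.+1 <= tau i) ->
    (alternations (fun i => c (tau i) e) M <= N)%N) ->
  exists N : nat, forall (e : seq R) (tau : nat -> R) (M : nat),
    (forall i, tau i.+1 <= tau i) ->
    (alternations (fun i => op (b (tau i) e) (c (tau i) e)) M <= N)%N.
  move=> [N NP] [N' N'P]; exists (N + N')%N => e tau M tau_le.
  by apply: (leq_trans (alternations_comb _ _ _ _)); rewrite leq_add ?NP ?N'P.
pose ev (f : formula R) (t : R) (e : seq R) : bool :=
  ordered_qelim.ord.qf_eval (t :: e) f.
elim: phi => //=.
- move=> b _ _; exists 0%N => e tau M _.
  by rewrite /alternations big1 // => i _; rewrite eqxx.
- move=> s s' _ /(atom s s' (fun x => x == 0))[N NP]; exists N => e tau M tau_le.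
  apply: leq_trans (NP e tau M tau_le); apply: leq_sum => i _.
  by rewrite !sgr_eq0 !subr_eq0 ![_ == GRing.eval _ s]eq_sym.
- move=> s s' _ /(atom s s' (fun x => 0 < x))[N NP]; exists N => e tau M tau_le.
  apply: leq_trans (NP e tau M tau_le); apply: leq_sum => i _.
  by rewrite !sgr_gt0 !subr_gt0.
- move=> s s' _ /(atom s s' (fun x => 0 <= x))[N NP]; exists N => e tau M tau_le.
  apply: leq_trans (NP e tau M tau_le); apply: leq_sum => i _.
  by rewrite !sgr_ge0 !subr_ge0.
- by move=> f IHf g IHg /andP[/IHf{}IHf /IHg{}IHg] /andP[/IHf fN /IHg gN];
    exact: (comb andb (ev f) (ev g) fN gN).
- by move=> f IHf g IHg /andP[/IHf{}IHf /IHg{}IHg] /andP[/IHf fN /IHg gN];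
    exact: (comb orb (ev f) (ev g) fN gN).
- by move=> f IHf g IHg /andP[/IHf{}IHf /IHg{}IHg] /andP[/IHf fN /IHg gN];
    exact: (comb implb (ev f) (ev g) fN gN).
- move=> f IHf /IHf{}IHf /IHf[N NP]; exists N => e tau M tau_le.
  by rewrite (alternations_not (fun i => ordered_qelim.ord.qf_eval (tau i :: e) f)) NP.
Qed.

(** Quantifier elimination reduces the claim to quantifier-free formulas, where
    the bound depends on the formula and not on the value of the parameter
    [u]. *)
Lemma definable_alternations (R : realType) (n : nat) (C : R -> R -> Prop) :
  definable (fun t u (_ : nat -> 'rV[R]_n) => C t u) ->
  exists N : nat, forall (u : R) (tau : nat -> R) (M : nat),
    (forall i, tau i.+1 <= tau i) ->
    (alternations (fun i => `[< C (tau i) u >]) M <= N)%N.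
Proof.
move=> [phi phiP]; pose wproj i bc :=
  qe_rcf.qfr_to_formula (@qe_rcf.wproj R i bc).
pose psi := ordered_qelim.ord.quantifier_elim wproj
  (ordered_qelim.ord.to_rform phi).
have psiP e : reflect (holds e phi) (ordered_qelim.ord.qf_eval e psi) :=
  qe_rcf.rcf_satP e phi.
have rphi := ordered_qelim.ord.to_rform_rformula phi.
have /andP[qf_psi r_psi] :=
  ordered_qelim.ord.quantifier_elim_wf (@qe_rcf.wf_QE_wproj R) rphi.
have [N NP] := qf_alternations qf_psi r_psi.
exists N => u tau M tau_le; apply: leq_trans (NP [:: u] tau M tau_le).
rewrite /alternations; apply: eq_leq; apply: eq_bigr => i _.
have E t : `[< C t u >] = ordered_qelim.ord.qf_eval [:: t; u] psi.
  apply/asboolP/psiP; first by move=> ?; apply/(phiP [:: t; u]).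
  by move=> /(phiP [:: t; u]).
by rewrite !E.
Qed.

(** * Variation and level crossings *)

(** A term with [c j = c i] and [j < i] has increment 0, since [c] is then
    constant from [j] to [i]; so the sum telescopes although the condition
    [c j < c i] is not the same as [j < i]. *)
Lemma sum_steps_below (R : realType) (c : nat -> R) (M i K : nat) :
  (forall j k, (j <= k <= M)%N -> c j <= c k) -> (i <= M)%N -> (K <= M)%N ->
  \sum_(j < K) (c j.+1 - c j) *+ (c j < c i)%R = c (minn K i) - c 0%N.
Proof.
move=> c_le iM; elim: K => [|K IHK] KM.
  by rewrite big_ord0 min0n subrr.
rewrite big_ord_recr /= IHK ?(ltnW KM)//.
have [Ki|iK] := ltnP K i.
  rewrite (minn_idPl Ki).
  have [_|ci] := ltP (c K) (c i); first by rewrite mulr1n; ring.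
  have cK : c K.+1 = c K.
    apply/eqP; rewrite eq_le (c_le K) ?leqnSn ?KM// andbT.
    by rewrite (le_trans (c_le _ i _) ci)// Ki iM.
  by rewrite mulr0n cK addr0.
rewrite (minn_idPr (leqW iK)) ltNge c_le ?addr0 //.
by rewrite iK ltnW.
Qed.

(** A discrete form of the Banach indicatrix formula: the variation of [g] is the
    integral over the thresholds [u] of the number of times that [g] crosses
    [u].  Here the integral is a finite sum over the gaps between the sorted
    values [c j] of [g], since the number of crossings is constant on each
    gap. *)
Lemma variation_le (R : realType) (g : nat -> R) (lo hi : R) (N M : nat) :
  (forall i, lo <= g i <= hi) ->
  (forall u, (alternations (fun i => u < g i)%R M <= N)%N) ->
  \sum_(i < M) `|g i - g i.+1| <= N%:R * (hi - lo).
Proof.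
move=> g_itv altN.
pose s := sort <=%R (mkseq g M.+1); pose c := nth 0 s.
have s_size : size s = M.+1 by rewrite size_sort size_mkseq.
have c_le j k : (j <= k <= M)%N -> c j <= c k.
  move=> /andP[jk kM]; apply: (sorted_leq_nth le_trans lexx) => //.
  - exact: sort_le_sorted.
  - by rewrite inE s_size ltnS (leq_trans jk).
  - by rewrite inE s_size ltnS.
have gc i : (i <= M)%N -> exists2 j, (j <= M)%N & g i = c j.
  move=> iM; have : g i \in s by rewrite mem_sort map_f// mem_iota ltnS.
  by move=> /(nthP 0)[j]; rewrite s_size ltnS => jM <-; exists j.
have c_itv j : (j <= M)%N -> lo <= c j <= hi.
  rewrite -ltnS -s_size => /(mem_nth 0); rewrite mem_sort.
  by move=> /mapP[i _]; rewrite -/(c j) => ->; exact: g_itv.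
have g_sum i : (i <= M)%N ->
    \sum_(j < M) (c j.+1 - c j) *+ (c j < g i)%R = g i - c 0%N.
  move=> /gc[k kM ->]; rewrite (sum_steps_below c_le kM)//.
  by rewrite (minn_idPr kM).
have g_dist i : (i < M)%N -> `|g i - g i.+1| <=
    \sum_(j < M) (c j.+1 - c j) *+ ((c j < g i) != (c j < g i.+1))%R.
  move=> iM; have -> : g i - g i.+1 = (g i - c 0%N) - (g i.+1 - c 0%N) by ring.
  rewrite -!g_sum ?(ltnW iM)// -sumrB.
  apply: le_trans (ler_norm_sum _ _ _) _; apply: ler_sum => j _.
  have cj : 0 <= c j.+1 - c j by rewrite subr_ge0 c_le// leqnSn ltn_ord.
  case: (c j < g i); case: (c j < g i.+1);
    by rewrite ?mulr1n ?mulr0n ?subrr ?subr0 ?sub0r ?normrN ?normr0 ?ger0_norm.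
apply: (@le_trans _ _ (\sum_(i < M) \sum_(j < M)
    (c j.+1 - c j) *+ ((c j < g i) != (c j < g i.+1))%R)).
  by apply: ler_sum => i _; exact: g_dist.
rewrite exchange_big /=.
apply: (@le_trans _ _ (\sum_(j < M) (c j.+1 - c j) *+ N)).
  apply: ler_sum => j _; rewrite sumrMnr.
  rewrite -[leLHS]mulr_natr -[leRHS]mulr_natr ler_wpM2l ?ler_nat ?altN//.
  by rewrite subr_ge0 c_le// leqnSn ltn_ord.
rewrite sumrMnl -(big_mkord xpredT (fun j => c j.+1 - c j)) telescope_sumr//.
rewrite -[leLHS]mulr_natl ler_wpM2l//.
have /andP[_ cM] := c_itv M (leqnn M).
by have /andP[c0 _] := c_itv 0%N (leq0n M); rewrite lerB.
Qed.

(** * Lexicographic minimization *)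

Definition argmins (R : realType) (T : Type) (h : T -> R) (K : set T) : set T :=
  [set z | K z /\ forall z', K z' -> h z <= h z'].

(** Minimizing the functions [h i] one after the other is lexicographic
    minimization. *)
Definition lexmin (R : realType) (T I : Type) (h : I -> T -> R) (s : seq I)
    (K : set T) : set T :=
  foldl (fun A i => argmins (h i) A) K s.

(** Compactness of one sublevel set is enough, which matters for the first
    minimization: the set of all proximal pairs of a given level need not be
    bounded. *)
Lemma argmins_compact (R : realType) (T : topologicalType) (h : T -> R)
    (K : set T) (z0 : T) :
  continuous h -> K z0 -> compact (K `&` [set z | h z <= h z0]) ->
  compact (argmins h K) /\ argmins h K !=set0.
Proof.
move=> ch Kz0 cK.
have [z [Kz hz] zmin] : exists2 z, (K `&` [set z | h z <= h z0]) z &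
    forall x, (K `&` [set z | h z <= h z0]) x -> h z <= h x.
  have ne : (K `&` [set z | h z <= h z0]) !=set0 by exists z0; split => /=.
  have [z /set_mem Kz zmin] := compact_EVT_min ne cK (continuous_subspaceT ch).
  by exists z => // x Kx; apply: zmin; rewrite inE.
have zm : argmins h K z.
  split=> // z' Kz'; have [hz'|/ltW hz'] := leP (h z') (h z0).
    by apply: zmin.
  exact: le_trans hz hz'.
split; last by exists z.
have -> : argmins h K =
    (K `&` [set z | h z <= h z0]) `&` h @^-1` [set x | x <= h z].
  apply/seteqP; split=> [y [Ky ymin]|y [[Ky _] /= hy]]; split => //=.
  - by split => //=; exact: ymin.
  - exact: ymin.
  - by move=> z' Kz'; apply: le_trans hy _; exact: zm.2.
apply: compact_closedI => //; apply: preimage_closed; last exact: closed_le.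
by move=> x _; exact: ch.
Qed.

Lemma lexmin_sub (R : realType) (T I : Type) (h : I -> T -> R) (s : seq I)
    (K : set T) :
  lexmin h s K `<=` K.
Proof.
elim: s K => [K z //|i s IHs K]; apply: subset_trans (IHs _) _.
by move=> z [].
Qed.

Lemma lexmin_nonempty (R : realType) (T : topologicalType) (I : Type)
    (h : I -> T -> R) (s : seq I) (K : set T) :
  (forall i, continuous (h i)) -> compact K -> K !=set0 ->
  lexmin h s K !=set0.
Proof.
move=> ch; elim: s K => [//|i s IHs] K cK [z Kz]; rewrite /lexmin /= -/(lexmin _ _).
have [|cA A0] := @argmins_compact _ _ (h i) K z (ch i) Kz.
  apply: compact_closedI => //.
  rewrite -[[set _ | _]]/(h i @^-1` [set x | x <= h i z]).
  by apply: preimage_closed; [move=> x _; exact: ch|exact: closed_le].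
exact: IHs.
Qed.

Lemma lexmin_eq (R : realType) (T : Type) (I : eqType) (h : I -> T -> R)
    (s : seq I) (K : set T) (z z' : T) (i : I) :
  i \in s -> lexmin h s K z -> lexmin h s K z' -> h i z = h i z'.
Proof.
elim: s K => [//|j s IHs] K; rewrite inE => /orP[/eqP-> |/IHs]; last exact.
have sub := @lexmin_sub R T I h s (argmins (h j) K).
move=> /sub[Kz zmin] /sub[Kz' z'min].
by apply/eqP; rewrite eq_le zmin// z'min.
Qed.

(** * Polynomial functions and the Euclidean norm *)

Lemma continuous_big_add (R : realType) (T : topologicalType) (I : Type)
    (s : seq I) (F : I -> T -> R) :
  (forall i, continuous (F i)) -> continuous (fun z => \sum_(i <- s) F i z).
Proof.
move=> cF; elim: s => [|i s IHs].
  rewrite [X in continuous X](_ : _ = cst 0); first exact: cst_continuous.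
  by apply/funext => z; rewrite big_nil.
rewrite [X in continuous X](_ : _ = (fun z => F i z + \sum_(i <- s) F i z)).
  by move=> z; apply: continuousD; [exact: cF|exact: IHs].
by apply/funext => z; rewrite big_cons.
Qed.

Lemma continuous_dot (R : realType) (n : nat) (T : topologicalType)
    (F G : T -> 'rV[R]_n) :
  continuous F -> continuous G -> continuous (fun z => dot (F z) (G z)).
Proof.
move=> cF cG; apply: continuous_big_add => i z.
have coord (H : T -> 'rV[R]_n) : continuous H ->
    {for z, continuous (fun y => H y 0 i)}.
  move=> cH; apply: (@continuous_comp _ _ _ H (fun v : 'rV[R]_n => v 0 i)).
    exact: cH.
  exact: coord_continuous.
by apply: continuousM; exact: coord.
Qed.

Lemma polyfun_differentiable (R : realType) (n : nat) (p : mpoly n R)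
    (x : 'rV[R]_n) :
  differentiable (polyfun p) x.
Proof.
have -> : polyfun p = (fun y : 'rV[R]_n =>
    \sum_(m <- msupp p) mcoeff m p * \prod_i (y 0 i) ^+ (m i)).
  by apply/funext => y; exact: mevalE.
elim: (msupp p : seq _) => [|m s IHs].
  by under eq_fun do rewrite big_nil; exact: differentiable_cst.
under eq_fun do rewrite big_cons.
apply: differentiableD => //; apply: differentiableM => //.
elim: (index_enum _) => [|i {IHs}s IHs].
  by under eq_fun do rewrite big_nil; exact: differentiable_cst.
under eq_fun do rewrite big_cons.
apply: differentiableM => //.
elim: (m i) => [|k IHk].
  by under eq_fun do rewrite expr0; exact: differentiable_cst.
under eq_fun do rewrite exprS.
by apply: differentiableM => //; exact: differentiable_coord.
Qed.

Lemma polyfun_continuous (R : realType) (n : nat) (p : mpoly n R) :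
  continuous (polyfun p).
Proof. by move=> x; apply: differentiable_continuous; exact: polyfun_differentiable. Qed.

Lemma dot_ge0 (R : realType) (n : nat) (x : 'rV[R]_n) : 0 <= dot x x.
Proof. by apply: sumr_ge0 => i _; rewrite -expr2 sqr_ge0. Qed.

Lemma enorm_sqr (R : realType) (n : nat) (x : 'rV[R]_n) :
  enorm x ^+ 2 = dot x x.
Proof. by rewrite sqr_sqrtr ?dot_ge0. Qed.

Lemma coord_le_enorm (R : realType) (n : nat) (x : 'rV[R]_n) (i : 'I_n) :
  `|x 0 i| <= enorm x.
Proof.
rewrite -(ler_pXn2r (n := 2)) ?nnegrE ?sqrtr_ge0//.
rewrite enorm_sqr real_normK ?num_real// /dot (bigD1 i) //= -expr2 lerDl.
by apply: sumr_ge0 => j _; rewrite -expr2 sqr_ge0.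
Qed.

(** The l1 norm is convenient for the length of the selected curve, whose
    variation is estimated coordinate by coordinate. *)
Definition l1norm (R : realType) (n : nat) (x : 'rV[R]_n) : R :=
  \sum_(i < n) `|x 0 i|.

Lemma dot_le (R : realType) (n : nat) (x v : 'rV[R]_n) :
  dot x v <= l1norm x * enorm v.
Proof.
rewrite /l1norm big_distrl; apply: ler_sum => i _ /=.
apply: le_trans (ler_norm _) _; rewrite normrM.
by rewrite ler_wpM2l ?coord_le_enorm.
Qed.

Lemma dot_le_sqr (R : realType) (n : nat) (x : 'rV[R]_n) :
  dot x x <= l1norm x ^+ 2.
Proof.
rewrite expr2 {1}/l1norm big_distrl; apply: ler_sum => i _ /=.
apply: le_trans (ler_norm _) _; rewrite normrM ler_wpM2l//.
rewrite /l1norm (bigD1 i)//= lerDl; exact: sumr_ge0.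
Qed.

Lemma mx_norm_le_enorm (R : realType) (n : nat) (x : 'rV[R]_n) :
  `|x| <= enorm x.
Proof.
rewrite /Num.Def.normr /= mx_normrE; apply/bigmax_leP.
by split=> [|[i j] _]; rewrite ?sqrtr_ge0//= ord1 coord_le_enorm.
Qed.

(** * Proximal steps and proximal pairs *)

Lemma exp_prox_continuous (R : realType) (n : nat) (f : 'rV[R]_n -> R)
    (xi : 'rV[R]_n) :
  continuous f -> continuous (exp_prox f xi).
Proof.
move=> cf; rewrite (_ : exp_prox f xi =
    (fun x => expR (dot (x - xi) (x - xi)) * f x)); last first.
  by apply/funext => x; rewrite /exp_prox enorm_sqr.
have cq : continuous (fun x : 'rV[R]_n => dot (x - xi) (x - xi)).
  apply: continuous_dot => z;
    by apply: continuousB; [exact: cvg_id|exact: cst_continuous].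
have ce : continuous (fun x : 'rV[R]_n => expR (dot (x - xi) (x - xi))).
  by move=> x; apply: (continuous_comp (cq x)); exact: continuous_expR.
by move=> x; exact: (continuousM (ce x) (cf x)).
Qed.

Lemma argmin_spec (R : realType) (n : nat) (X : set 'rV[R]_n)
    (phi : 'rV[R]_n -> R) :
  compact X -> X !=set0 -> continuous phi ->
  X (argmin X phi) /\ forall x, X x -> phi (argmin X phi) <= phi x.
Proof.
move=> cX X0 cphi.
have [c /set_mem Xc cmin] := compact_EVT_min X0 cX (continuous_subspaceT cphi).
rewrite /argmin; case: xgetP => [a -> //|/(_ c)[]].
by split=> // x Xx; apply: cmin; rewrite inE.
Qed.

(** The pair [(x, v)] satisfies a lower bound of [f] on [X] by a concave quadratic
    that touches [f] at [x] with slope proportional to [|v|].  It is the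
    consequence of proximal minimality that is polynomial in [x], [v] and [y], hence first
    order. *)
Definition prox_pairs (R : realType) (n : nat) (X : set 'rV[R]_n)
    (f : 'rV[R]_n -> R) : set ('rV[R]_n * 'rV[R]_n) :=
  [set z | X z.1 /\ forall y, X y ->
     f z.1 * (1 - 2 * dot (y - z.1) z.2 - dot (y - z.1) (y - z.1)) <= f y].

Definition prox_level (R : realType) (n : nat) (X : set 'rV[R]_n)
    (f : 'rV[R]_n -> R) (t : R) : set ('rV[R]_n * 'rV[R]_n) :=
  [set z | prox_pairs X f z /\ f z.1 = t].

(** Dividing the minimality inequality by the exponential at [a] leaves
    [f a * exp (- q) <= f y] with [q = |y - a|^2 + 2 <y - a, a - xi>], and
    [1 - q <= exp (- q)]. *)
Lemma prox_pairs_argmin (R : realType) (n : nat) (X : set 'rV[R]_n)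
    (f : 'rV[R]_n -> R) (xi a : 'rV[R]_n) :
  (forall x, X x -> 0 < f x) -> X a ->
  (forall x, X x -> exp_prox f xi a <= exp_prox f xi x) ->
  prox_pairs X f (a, a - xi).
Proof.
move=> f_gt0 Xa amin; split=> //= y Xy.
have := amin y Xy; rewrite /exp_prox !enorm_sqr.
have -> : dot (y - xi) (y - xi) = dot (y - a) (y - a) +
    2 * dot (y - a) (a - xi) + dot (a - xi) (a - xi).
  rewrite /dot big_distrr -!big_split; apply: eq_bigr => i _ /=.
  rewrite !mxE; ring.
rewrite expRD mulrAC [leRHS]mulrC ler_pM2l ?expR_gt0// => amin'.
set q := dot (y - a) (y - a) + _ in amin'.
have fq : f a * expR (- q) <= f y.
  by rewrite expRN ler_pdivrMr ?expR_gt0 // mulrC.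
apply: le_trans fq; rewrite ler_pM2l ?f_gt0//.
by apply: le_trans (expR_ge1Dx _); rewrite /q; lra.
Qed.

Lemma prox_descent (R : realType) (n : nat) (X : set 'rV[R]_n)
    (f : 'rV[R]_n -> R) (xi a : 'rV[R]_n) :
  (forall x, X x -> 0 < f x) -> X xi -> X a ->
  (forall x, X x -> exp_prox f xi a <= exp_prox f xi x) ->
  f a * (1 + enorm (a - xi) ^+ 2) <= f xi.
Proof.
move=> f_gt0 Xxi Xa /(_ xi Xxi); rewrite /exp_prox !enorm_sqr subrr.
rewrite [dot 0 0]big1 ?expR0 ?mul1r => [|i _]; last by rewrite mxE mul0r.
apply: le_trans; rewrite [leRHS]mulrC ler_pM2l ?f_gt0//.
exact: expR_ge1Dx.
Qed.

Lemma prox_pairs_closed (R : realType) (n : nat) (X : set 'rV[R]_n)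
    (f : 'rV[R]_n -> R) :
  closed X -> continuous f -> closed (prox_pairs X f).
Proof.
move=> clX cf.
have cfst : continuous (@fst 'rV[R]_n 'rV[R]_n) by move=> z; exact: cvg_fst.
have csnd : continuous (@snd 'rV[R]_n 'rV[R]_n) by move=> z; exact: cvg_snd.
have cy (y : 'rV[R]_n) : continuous (fun z : 'rV[R]_n * 'rV[R]_n => y - z.1).
  by move=> z; apply: continuousB; [exact: cst_continuous|exact: cfst].
pose G y (z : 'rV[R]_n * 'rV[R]_n) :=
  f z.1 * (1 - 2 * dot (y - z.1) z.2 - dot (y - z.1) (y - z.1)).
have cG y : continuous (G y).
  have cfz : continuous (fun z : 'rV[R]_n * 'rV[R]_n => f z.1).
    by move=> z; apply: (continuous_comp (cfst z)); exact: cf.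
  have c1 := continuous_dot (cy y) csnd.
  have c2 := continuous_dot (cy y) (cy y).
  move=> z; apply: (continuousM (cfz z)).
  apply: continuousB; last exact: c2.
  apply: continuousB; first exact: cst_continuous.
  by apply: continuousM; [exact: cst_continuous|exact: c1].
have -> : prox_pairs X f = (fst @^-1` X) `&`
    \bigcap_(y in X) (G y @^-1` [set t | t <= f y]).
  by apply/seteqP; split=> z [].
apply: closedI; first by apply: preimage_closed => // z _; exact: cfst.
apply: closed_bigI => y _; apply: preimage_closed; last exact: closed_le.
by move=> z _; exact: cG.
Qed.

Lemma prox_level_compact (R : realType) (n : nat) (X : set 'rV[R]_n)
    (f : 'rV[R]_n -> R) (t b : R) :
  compact X -> continuous f ->
  compact (prox_level X f t `&` [set z | dot z.2 z.2 <= b]).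
Proof.
move=> cX cf.
have cfst : continuous (@fst 'rV[R]_n 'rV[R]_n) by move=> z; exact: cvg_fst.
have csnd : continuous (@snd 'rV[R]_n 'rV[R]_n) by move=> z; exact: cvg_snd.
have clX : closed X by apply: compact_closed => //; exact: norm_hausdorff.
pose B : set 'rV[R]_n := [set v | dot v v <= b].
have cB : compact B.
  apply: bounded_closed_compact.
    exists (Num.sqrt b); split; first exact: num_real.
    move=> c bc v vb; apply: le_trans (mx_norm_le_enorm v) _.
    by apply: le_trans (ltW bc); exact: (ler_wsqrtr vb).
  rewrite /B -[[set _ | _]]/((fun v => dot v v) @^-1` [set t | t <= b]).
  apply: preimage_closed; last exact: closed_le.
  have cid : continuous (fun v : 'rV[R]_n => v) by move=> v; exact: cvg_id.
  have cdot := continuous_dot cid cid.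
  by move=> v _; exact (cdot v).
apply: (subclosed_compact _ (compact_setX cX cB)); last first.
  by move=> z [[[Xz _] _] zb]; split.
apply: closedI.
  rewrite /prox_level -[[set _ | _]]/(prox_pairs X f `&`
    (f \o fst) @^-1` [set s | s = t]).
  apply: closedI; first exact: prox_pairs_closed.
  apply: preimage_closed; last exact: closed_eq.
  by move=> z _; apply: (continuous_comp (cfst z)); exact: cf.
rewrite -[[set _ | _]]/((fun z : 'rV[R]_n * 'rV[R]_n => dot z.2 z.2) @^-1`
  [set t | t <= b]).
apply: preimage_closed; last exact: closed_le.
have cdot := continuous_dot csnd csnd.
by move=> v _; exact (cdot v).
Qed.

(** * Convergence and criticality *)

Lemma cvg_finite_length (R : realType) (n : nat) (a : nat -> 'rV[R]_n)
    (d : nat -> R) (B : R) :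
  (forall i, `|a i.+1 - a i| <= d i) ->
  (forall M, \sum_(i < M) d i <= B) -> cvgn a.
Proof.
move=> ad dB.
have d_ge0 i : 0 <= d i by apply: le_trans (ad i); exact: normr_ge0.
have /cauchy_cvgP/cauchy_seriesP d_cvg : cvgn (series d).
  apply: nondecreasing_is_cvgn; first exact: nondecreasing_series.
  by exists B => _ [M _ <-]; rewrite /series /= big_mkord.
have a_cvg : cvgn (series (telescope a)).
  apply/cauchy_cvgP/cauchy_seriesP => e /d_cvg; apply: filterS => -[m k] /=.
  rewrite ger0_norm ?sumr_ge0//; apply: le_lt_trans.
  by apply: le_trans (ler_norm_sum _ _ _) _; apply: ler_sum => i _; exact: ad.
rewrite (_ : a = (fun i => a 0%N + series (telescope a) i)); last first.
  by apply/funext => i; exact: eq_sum_telescope.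
by apply: is_cvgD => //; exact: is_cvg_cst.
Qed.

Lemma derive_gradient (R : realType) (n : nat) (f : 'rV[R]_n -> R)
    (a v : 'rV[R]_n) :
  differentiable f a -> 'D_v f a = dot (gradient f a) v.
Proof.
move=> fa; rewrite deriveE// [in LHS](row_sum_delta v) linear_sum.
by apply: eq_bigr => i _; rewrite linearZ /= mxE deriveE// mulrC.
Qed.

(** At [y = a + h (x - a)] the inequality of the pair [(a, 0)] reads
    [f y - f a >= - h^2 * f a * |x - a|^2]; the error is of second order, so the
    derivative at [h = 0] from the right is nonnegative. *)
Lemma prox_pairs_critical (R : realType) (n : nat) (X : set 'rV[R]_n)
    (f : 'rV[R]_n -> R) (a : 'rV[R]_n) :
  convex_set X -> differentiable f a -> prox_pairs X f (a, 0) ->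
  lower_critical X f a.
Proof.
move=> convX fa [Xa fmin]; rewrite /= in Xa fmin; split => // x Xx.
rewrite -derive_gradient//; set v := x - a.
have dfa : (fun h => h^-1 * (f (h *: v + a) - f a)) @ 0^'+ --> 'D_v f a.
  by apply: cvg_dnbhs_at_right; exact: (@diff_derivable _ _ _ f a v fa).
have hcvg : (fun h : R => h * (f a * dot v v)) @ 0^'+ --> (0 : R).
  rewrite -[X in _ --> X](mul0r (f a * dot v v)).
  apply: cvg_at_right_filter; apply: cvgM; [exact: cvg_id|exact: cvg_cst].
have sum_cvg : (fun h => h^-1 * (f (h *: v + a) - f a) + h * (f a * dot v v))
    @ 0^'+ --> 'D_v f a by rewrite -[X in _ --> X]addr0; exact: cvgD.
apply: (cvgr_to_ge sum_cvg).
near=> h.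
have h0 : 0 < h by near: h; exact: nbhs_right_gt.
have h1 : h <= 1 by near: h; apply: nbhs_right_ltW.
have Xh : X (h *: v + a).
  have := convX x a (Itv01 (ltW h0) h1); rewrite !inE => /(_ Xx Xa).
  congr X; rewrite /conv /= /v scalerBr scalerBl scale1r.
  by rewrite addrCA addrC.
have := fmin _ Xh; rewrite addrK.
have -> : dot (h *: v) 0 = 0.
  by rewrite /dot big1 // => i _; rewrite !mxE mulr0.
have -> : dot (h *: v) (h *: v) = h ^+ 2 * dot v v.
  by rewrite /dot big_distrr; apply: eq_bigr => i _ /=; rewrite !mxE; ring.
move=> fh; rewrite -(pmulr_rge0 _ h0) mulrDr mulrA divff ?gt_eqF// mul1r.
by nra.
Unshelve. all: by end_near.
Qed.

(** * Definable selection of proximal pairs *)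

(** The competitor is quantified in the two blocks after those of the pair.
    Stating definability for every position [k] of the pair makes it possible
    to apply the hypothesis on [K] to the competitor as well. *)
Lemma definable_argmins (R : realType) (n : nat)
    (K : R -> set ('rV[R]_n * 'rV[R]_n)) (h : 'rV[R]_n * 'rV[R]_n -> R) :
  (forall k, polynomial_in (fun _ _ E => h (E k, E k.+1))) ->
  (forall k, definable (fun t _ E => K t (E k, E k.+1))) ->
  forall k, definable (fun t _ E => argmins h (K t) (E k, E k.+1)).
Proof.
move=> ph dK k; apply: definable_and => //.
have := definable_forall k.+2 (definable_forall k.+3
  (definable_imp (dK k.+2) (definable_le (ph k) (ph k.+2)))).
congr definable; apply/funext => t; apply/funext => u; apply/funext => E.
have E0 v w : upd (upd E k.+2 v) k.+3 w k = E k by rewrite /upd !ifF//; lia.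
have E1 v w : upd (upd E k.+2 v) k.+3 w k.+1 = E k.+1.
  by rewrite /upd !ifF//; lia.
have E2 v w : upd (upd E k.+2 v) k.+3 w k.+2 = v.
  by rewrite /upd ifF ?eqxx//; lia.
have E3 v w : upd (upd E k.+2 v) k.+3 w k.+3 = w by rewrite /upd eqxx.
apply/propext; split => [h_min [v w] Kvw|h_min v w].
  by have := h_min v w; rewrite E0 E1 E2 E3; exact.
by rewrite E0 E1 E2 E3; exact: h_min.
Qed.

Lemma definable_lexmin (R : realType) (n : nat) (I : Type)
    (h : I -> 'rV[R]_n * 'rV[R]_n -> R) (s : seq I)
    (K : R -> set ('rV[R]_n * 'rV[R]_n)) :
  (forall i k, polynomial_in (fun _ _ E => h i (E k, E k.+1))) ->
  (forall k, definable (fun t _ E => K t (E k, E k.+1))) ->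
  forall k, definable (fun t _ E => lexmin h s (K t) (E k, E k.+1)).
Proof.
move=> ph; elim: s K => [K dK|i s IHs K dK]; first exact: dK.
apply: (IHs (fun t => argmins (h i) (K t))).
exact: definable_argmins (ph i) dK.
Qed.

Lemma definable_prox_level (R : realType) (n : nat) (X : set 'rV[R]_n)
    (p : mpoly n R) (k : nat) :
  semialgebraic X ->
  definable (fun t _ E => prox_level X (polyfun p) t (E k, E k.+1)).
Proof.
move=> sX.
have pf j := @polynomial_in_polyfun R n j p.
have pdot j : polynomial_in (fun _ _ (E : nat -> 'rV[R]_n) =>
    1 - 2 * dot (E j - E k) (E k.+1) - dot (E j - E k) (E j - E k)).
  have pc i : polynomial_in (fun _ _ (E : nat -> 'rV[R]_n) => (E j - E k) 0 i).
    have := polynomial_inB (@polynomial_in_coord R n j i)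
                           (@polynomial_in_coord R n k i).
    by congr polynomial_in; do 3 apply/funext => ?; rewrite !mxE.
  apply: polynomial_inB; last first.
    by apply: polynomial_in_sum => i; exact: polynomial_inM.
  apply: polynomial_inB; first exact: polynomial_in_cst.
  apply: polynomial_inM; first exact: polynomial_in_cst.
  apply: polynomial_in_sum => i; apply: polynomial_inM => //.
  exact: polynomial_in_coord.
apply: definable_and; last exact: (definable_eq (pf k) (@polynomial_in_fst R n)).
apply: definable_and; first exact: semialgebraic_definable.
have := definable_forall k.+2 (definable_imp
  (semialgebraic_definable k.+2 sX)
  (definable_le (polynomial_inM (pf k) (pdot k.+2)) (pf k.+2))).
congr definable; apply/funext => t; apply/funext => u; apply/funext => E.
have E0 v : upd E k.+2 v k = E k by rewrite /upd ifF//; lia.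
have E1 v : upd E k.+2 v k.+1 = E k.+1 by rewrite /upd ifF//; lia.
have E2 v : upd E k.+2 v k.+2 = v by rewrite /upd eqxx.
apply/propext; split => h v; have := h v; rewrite E0 E1 E2; exact.
Qed.

(** The quantities to be minimized on a level: the key [None] is the squared
    length of the vector, the key [Some j] is the [j]-th coordinate of the
    point. *)
Definition prox_key (R : realType) (n : nat) (i : option 'I_n)
    (z : 'rV[R]_n * 'rV[R]_n) : R :=
  if i is Some j then z.1 0 j else dot z.2 z.2.

(** A definable choice of one point on each level.  The shortest vector comes
    first, so that it is at most as long as the step of the algorithm at this
    level; the coordinates then determine the point. *)
Definition prox_select (R : realType) (n : nat) (X : set 'rV[R]_n)
    (f : 'rV[R]_n -> R) (t : R) : set ('rV[R]_n * 'rV[R]_n) :=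
  lexmin (@prox_key R n) (None :: [seq Some j | j <- enum 'I_n])
    (prox_level X f t).

Lemma prox_select_exists (R : realType) (n : nat) (X : set 'rV[R]_n)
    (f : 'rV[R]_n -> R) (t : R) (z0 : 'rV[R]_n * 'rV[R]_n) :
  compact X -> continuous f -> prox_level X f t z0 ->
  exists2 z, prox_select X f t z & enorm z.2 <= enorm z0.2.
Proof.
move=> cX cf z0t.
have csnd : continuous (@snd 'rV[R]_n 'rV[R]_n) by move=> z; exact: cvg_snd.
have ckey i : continuous (@prox_key R n i).
  case: i => [j|]; last exact: continuous_dot.
  move=> z; apply: (@continuous_comp _ _ _ fst (fun v : 'rV[R]_n => v 0 j)).
    exact: cvg_fst.
  exact: coord_continuous.
have [cA A0] := argmins_compact (ckey None) z0t
  (prox_level_compact (t := t) (b := dot z0.2 z0.2) cX cf).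
have [z zP] := lexmin_nonempty [seq Some j | j <- enum 'I_n] ckey cA A0.
exists z => //.
have [_ zmin] := lexmin_sub zP.
by apply: ler_wsqrtr; exact: zmin z0 z0t.
Qed.

Lemma prox_select_level (R : realType) (n : nat) (X : set 'rV[R]_n)
    (f : 'rV[R]_n -> R) (t : R) (z : 'rV[R]_n * 'rV[R]_n) :
  prox_select X f t z -> prox_level X f t z.
Proof. exact: lexmin_sub. Qed.

Lemma prox_select_coord (R : realType) (n : nat) (X : set 'rV[R]_n)
    (f : 'rV[R]_n -> R) (t : R) (z z' : 'rV[R]_n * 'rV[R]_n) (i : 'I_n) :
  prox_select X f t z -> prox_select X f t z' -> z.1 0 i = z'.1 0 i.
Proof.
apply: (lexmin_eq (h := @prox_key R n) (i := Some i)).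
by rewrite inE map_f// mem_enum.
Qed.

(** Since the selected point is unique, comparing its [i]-th coordinate with [u]
    is the first order condition that some selected pair has its coordinate
    above [u]. *)
Lemma prox_select_alternations (R : realType) (n : nat) (X : set 'rV[R]_n)
    (p : mpoly n R) (i : 'I_n) :
  semialgebraic X ->
  exists N : nat, forall (tau : nat -> R)
    (z : nat -> 'rV[R]_n * 'rV[R]_n) (u : R) (M : nat),
  (forall k, tau k.+1 <= tau k) ->
  (forall k, prox_select X (polyfun p) (tau k) (z k)) ->
  (alternations (fun k => u < (z k).1 0 i)%R M <= N)%N.
Proof.
move=> sX.
have [|N NP] := @definable_alternations R n
  (fun t u => exists v w, prox_select X (polyfun p) t (v, w) /\ u < v 0 i).
  pose B (t u : R) (E : nat -> 'rV[R]_n) :=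
    prox_select X (polyfun p) t (E 0%N, E 1%N) /\ u < E 0%N 0 i.
  apply: (@definable_exists R n 0 _ (@definable_exists R n 1 B _)).
  apply: definable_and; last first.
    by apply: definable_lt; [exact: polynomial_in_snd|exact: polynomial_in_coord].
  apply: (@definable_lexmin R n _ (@prox_key R n)
    (None :: [seq Some j | j <- enum 'I_n])
    (prox_level X (polyfun p)) _ _ 0%N) => [[j|] k|k].
  - exact: polynomial_in_coord.
  - apply: polynomial_in_sum => j.
    by apply: polynomial_inM; exact: polynomial_in_coord.
  - exact: definable_prox_level.
exists N => tau z u M tau_le zP; apply: leq_trans (NP u tau M tau_le).
rewrite /alternations; apply: eq_leq; apply: eq_bigr => k _.
have E j : (u < (z j).1 0 i)%R =
    `[< exists v w, prox_select X (polyfun p) (tau j) (v, w) /\ u < v 0 i >].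
  apply/idP/asboolP => [uz|[v [w [vw uv]]]].
    by exists (z j).1, (z j).2; rewrite -surjective_pairing; split.
  by rewrite (prox_select_coord i (zP j) vw).
by rewrite !E.
Qed.

(** Each coordinate stays in a bounded interval and crosses every threshold a
    uniformly bounded number of times. *)
Lemma prox_select_finite_length (R : realType) (n : nat) (X : set 'rV[R]_n)
    (p : mpoly n R) (tau : nat -> R) (z : nat -> 'rV[R]_n * 'rV[R]_n) :
  semialgebraic X -> compact X ->
  (forall k, tau k.+1 <= tau k) ->
  (forall k, prox_select X (polyfun p) (tau k) (z k)) ->
  exists B, forall M, \sum_(k < M) l1norm ((z k.+1).1 - (z k).1) <= B.
Proof.
move=> sX cX tau_le zP.
have [C C_gt0 CX] : exists2 C : R, 0 < C & forall x, X x -> `|x| <= C.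
  have /ex_strict_bound_gt0[C C0 CX] := compact_bounded cX.
  by exists C => // x /CX /ltW.
have [N NP] := choice (fun i => @prox_select_alternations R n X p i sX).
exists (\sum_(i < n) (N i)%:R * (C - (- C))) => M.
rewrite /l1norm exchange_big; apply: ler_sum => i _ /=.
under eq_bigr do rewrite !mxE distrC.
apply: (@variation_le _ (fun k => (z k).1 0 i)) => [k|u]; last exact: NP.
rewrite -ler_norml; have [[Xz _] _] := prox_select_level (zP k).
apply: le_trans (CX _ Xz).
rewrite {2}/Num.Def.normr /= mx_normrE.
exact: (@le_bigmax _ _ _ _ (fun ij => `|(z k).1 ij.1 ij.2|) (0, i)).
Qed.

(** * Summability of the steps *)

(** Summing the recursion bounds the sum [S] by [d 0 + S / 2 + B]. *)
Lemma sum_halving (R : realType) (d c : nat -> R) (B : R) :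
  (forall i, 0 <= d i) -> (forall i, d i.+1 <= d i / 2 + c i) ->
  (forall M, \sum_(i < M) c i <= B) ->
  forall M, \sum_(i < M) d i <= 2 * (d 0%N + B).
Proof.
move=> d_ge0 d_le cB M.
have h1 : \sum_(i < M) d i <= \sum_(i < M.+1) d i by rewrite big_ord_recr lerDl.
have h2 : \sum_(i < M) d i.+1 <= (\sum_(i < M) d i) / 2 + B.
  apply: (@le_trans _ _ (\sum_(i < M) (d i / 2 + c i))).
    by apply: ler_sum => i _; exact: d_le.
  by rewrite big_split -mulr_suml lerD2l.
rewrite big_ord_recl /= in h1.
have : \sum_(i < M) d (bump 0 i) = \sum_(i < M) d i.+1 by [].
by lra.
Qed.

(** With [C = F / m >= 1], the square of [d / 2 + 2 C D] is
    [d^2 / 4 + 2 C D d + 4 C^2 D^2], which dominates [C (2 D d + D^2)]. *)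
Lemma prox_step_le (R : realType) (F m d d' D : R) :
  0 < m -> m <= F -> 0 <= d -> 0 <= d' -> 0 <= D ->
  m * d' ^+ 2 <= F * (2 * (D * d) + D ^+ 2) ->
  d' <= d / 2 + 2 * (F / m) * D.
Proof.
move=> m_gt0 mF d_ge0 d'_ge0 D_ge0 le_sq; set C := F / m.
have C_ge1 : 1 <= C by rewrite ler_pdivlMr// mul1r.
have {}le_sq : d' ^+ 2 <= C * (2 * (D * d) + D ^+ 2).
  by rewrite /C mulrAC ler_pdivlMr// mulrC.
have CD_ge0 : 0 <= C * D by rewrite mulr_ge0// (le_trans ler01).
have rhs_ge0 : 0 <= d / 2 + 2 * C * D by lra.
rewrite -(ler_pXn2r (n := 2)) ?nnegrE//.
apply: le_trans le_sq _.
have : 0 <= C * (C - 1) * D ^+ 2 by rewrite mulr_ge0 ?sqr_ge0// mulr_ge0 ?subr_ge0//; lra.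
have : 0 <= C ^+ 2 * D ^+ 2 by rewrite mulr_ge0 ?sqr_ge0.
have : 0 <= d ^+ 2 by exact: sqr_ge0.
by rewrite !expr2; nra.
Qed.

Theorem theorem1 (R : realType) (n : nat) (X : set 'rV[R]_n)
    (p : mpoly n R) (mu : R) (a0 : 'rV[R]_n) (a : nat -> 'rV[R]_n) :
  let f := polyfun p in
  compact X ->
  convex_set X ->
  semialgebraic X ->
  (forall x, X x -> 0 < f x) ->
  0 < mu ->
  (forall xi, X xi -> strongly_convex mu X (exp_prox f xi)) ->
  X a0 ->
  a 0%N = a0 ->
  (forall nu : nat, a nu.+1 = argmin X (exp_prox f (a nu))) ->
  exists2 astar : 'rV[R]_n, a @ \oo --> astar & lower_critical X f astar.
Proof.
move=> f cX convX sX f_gt0 _ _ Xa0 a_0 a_S.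
have cf : continuous f by exact: polyfun_continuous.
have X0 : X !=set0 by exists a0.
have a_min k : X (a k.+1) /\
    forall x, X x -> exp_prox f (a k) (a k.+1) <= exp_prox f (a k) x.
  by rewrite a_S; apply: argmin_spec => //; exact: exp_prox_continuous.
have Xa k : X (a k) by case: k => [|k]; [rewrite a_0|case: (a_min k)].
have [m m_gt0 mX] : exists2 m, 0 < m & forall x, X x -> m <= f x.
  have [b /set_mem Xb bmin] := compact_EVT_min X0 cX (continuous_subspaceT cf).
  by exists (f b) => [|x Xx]; [exact: f_gt0|apply: bmin; rewrite inE].
have [F FX] : exists F, forall x, X x -> f x <= F.
  have [b _ bmax] := compact_EVT_max X0 cX (continuous_subspaceT cf).
  by exists (f b) => x Xx; apply: bmax; rewrite inE.
have mF : m <= F by exact: le_trans (mX _ Xa0) (FX _ Xa0).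
pose tau k := f (a k.+1); pose d k := enorm (a k.+1 - a k).
have d_ge0 k : 0 <= d k by exact: sqrtr_ge0.
have descent k : m * d k ^+ 2 <= f (a k) - f (a k.+1).
  have := prox_descent f_gt0 (Xa k) (Xa k.+1) (a_min k).2.
  rewrite -/(d k) => h.
  have : m * d k ^+ 2 <= f (a k.+1) * d k ^+ 2.
    by rewrite ler_wpM2r ?sqr_ge0// mX.
  by move: h; rewrite mulrDr mulr1; lra.
have tau_le k : tau k.+1 <= tau k.
  rewrite -subr_ge0; apply: le_trans (descent k.+1).
  by rewrite mulr_ge0 ?sqr_ge0// ltW.
have a_prox k : prox_pairs X f (a k.+1, a k.+1 - a k).
  exact: prox_pairs_argmin f_gt0 (Xa _) (a_min k).2.
(* The pair of the algorithm at level [tau k] competes in the selection, so the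
   selected vector is at most as long as the step [d k]. *)
have [z zP] := choice (fun k => let: ex_intro2 z zs zd :=
  prox_select_exists (t := tau k) cX cf (conj (a_prox k) erefl) in
  ex_intro _ z (conj zs zd)).
have [B zB] := prox_select_finite_length sX cX tau_le (fun k => (zP k).1).
pose D k := l1norm ((z k.+1).1 - (z k).1).
have D_ge0 k : 0 <= D k by exact: sumr_ge0.
have d_le k : d k.+1 <= d k / 2 + 2 * (F / m) * D k.
  apply: prox_step_le => //; apply: le_trans (descent k.+1) _.
  rewrite -/(tau k) -/(tau k.+1).
  have [[[Xz zprox] ztau] [[Xz' _] ztau']] :=
    (prox_select_level (zP k).1, prox_select_level (zP k.+1).1).
  (* The inequality of the pair selected at level [tau k] is tested at the point
     selected at level [tau k.+1]. *)
  have := zprox _ Xz'; rewrite ztau ztau' => h.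
  have h1 := dot_le ((z k.+1).1 - (z k).1) (z k).2.
  have h2 := dot_le_sqr ((z k.+1).1 - (z k).1).
  rewrite -/(D k) in h1 h2.
  have h3 : D k * enorm (z k).2 <= D k * d k by rewrite ler_wpM2l// (zP k).2.
  apply: (@le_trans _ _ (tau k * (2 * (D k * d k) + D k ^+ 2))); last first.
    by rewrite ler_wpM2r ?FX// addr_ge0 ?sqr_ge0// !mulr_ge0.
  have tau_ge0 : 0 <= tau k by rewrite ltW// f_gt0.
  apply: (@le_trans _ _ (tau k * (2 * dot ((z k.+1).1 - (z k).1) (z k).2 +
    dot ((z k.+1).1 - (z k).1) ((z k.+1).1 - (z k).1)))); first by lra.
  by rewrite ler_wpM2l//; lra.
have cB M : \sum_(k < M) 2 * (F / m) * D k <= 2 * (F / m) * B.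
  rewrite -mulr_sumr ler_wpM2l// mulr_ge0// divr_ge0 ?(ltW m_gt0)//.
  exact: le_trans (ltW m_gt0) mF.
have a_cvg : cvgn a.
  apply: (cvg_finite_length (d := d)) (sum_halving d_ge0 d_le cB) => k.
  exact: mx_norm_le_enorm.
exists (limn a) => //; apply: prox_pairs_critical => //.
  exact: polyfun_differentiable.
have aS_cvg : (fun k => a k.+1) @ \oo --> limn a by rewrite cvg_shiftS.
have step_cvg : (fun k => a k.+1 - a k) @ \oo --> (0 : 'rV[R]_n).
  by rewrite -(subrr (limn a)); exact: cvgB.
have clX : closed X by apply: compact_closed => //; exact: norm_hausdorff.
have pair_cvg : (fun k => (a k.+1, a k.+1 - a k)) @ \oo -->
    ((limn a, 0) : 'rV[R]_n * 'rV[R]_n).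
  exact (cvg_pair aS_cvg step_cvg).
have := @closed_cvg _ _ _ _ _ _ (prox_pairs_closed clX cf) _ _ pair_cvg.
by apply; apply: nearW => k; exact: a_prox.
Qed.
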